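(* Let $M$ be one of the following hypersurfaces, where $\alpha_1,\alpha_2$ are smooth functions with $\alpha_1'(s)^2+\alpha_2'(s)^2=1$ and with $\alpha_1'$ and $\alpha_2'$ nowhere vanishing: (a) the hypersurface of $\mathbb{S}^3\times\mathbb{R}$ given by $$x(s,v,w)=\big(\cos(\alpha_1(s))\cos v,\ \cos(\alpha_1(s))\sin v,\ \sin(\alpha_1(s))\cos w,\ \sin(\alpha_1(s))\sin w,\ \alpha_2(s)\big),$$ with $\cos(\alpha_1(s))>0$ and $\sin(\alpha_1(s))>0$; (b) the hypersurface of $\mathbb{H}^3\times\mathbb{R}$ given by $$x(s,v,w)=\big(\cosh(\alpha_1(s))\cosh v,\ \cosh(\alpha_1(s))\sinh v,\ \sinh(\alpha_1(s))\cos w,\ \sinh(\alpha_1(s))\sin w,\ \alpha_2(s)\big),$$ with $\sinh(\alpha_1(s))>0$. Then there is no smooth function $\lambda$ on $M$ such that $(M,g,T,\lambda)$ is an almost Ricci soliton.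
   Context: $\mathbb{S}^3\times\mathbb{R}=\{x\in\mathbb{E}^5 : x_1^2+x_2^2+x_3^2+x_4^2=1\}$ and $\mathbb{H}^3\times\mathbb{R}=\{x\in\mathbb{L}^5 : -x_1^2+x_2^2+x_3^2+x_4^2=-1,\ x_1>0\}$, where $\mathbb{L}^5$ has metric $-dx_1^2+dx_2^2+\dots+dx_5^2$. $g$ is the induced metric on $M$, $N$ is a unit normal vector field of $M$ in the product space, and $T$ is the tangential part of $\frac{\partial}{\partial x_5}$ in $\frac{\partial}{\partial x_5}\big|_M=T+\sigma N$. $(M,g,\xi,\lambda)$, with $\lambda$ a smooth function on $M$, is an almost Ricci soliton if $\frac12\mathcal{L}_\xi g+\mathrm{Ric}=\lambda g$, where $\mathcal{L}_\xi g$ is the Lie derivative of $g$ and $\mathrm{Ric}$ is the Ricci tensor of $(M,g)$. *)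

(* Defs.v *)
From HB Require Import structures.
From mathcomp Require Import all_boot all_order all_algebra.
From mathcomp Require Import all_classical all_reals all_analysis.
From mathcomp Require Import ring.

Set Implicit Arguments.
Unset Strict Implicit.
Unset Printing Implicit Defensive.

Import Order.TTheory GRing.Theory Num.Theory.
Import numFieldNormedType.Exports.
Local Open Scope classical_set_scope.
Local Open Scope ring_scope.

Section Smoothness.
Context {R : realType} {V W : normedModType R}.

Fixpoint iter_derive (vs : seq V) (f : V -> W) : V -> W :=
  if vs is v :: vs' then 'D_v (iter_derive vs' f) else f.

(* On an open subset of a finite-dimensional space this is C^oo: every iterated
   directional derivative, of every order, is differentiable on D. *)
Definition smooth_on (D : set V) (f : V -> W) : Prop :=
  forall (vs : seq V) (p : V), D p -> differentiable (iter_derive vs f) p.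

End Smoothness.

(* Tensor calculus in a single coordinate chart: a metric is given by its Gram
   matrix in the coordinate frame, and a vector field by its row of components.
   All indices run over 'I_n.+1. *)
Section ChartGeometry.
Context {R : realType} {n : nat}.
Notation point := 'rV[R]_n.+1.
Notation metric := (point -> 'M[R]_n.+1).

Definition partial {W : normedModType R} (i : 'I_n.+1) (f : point -> W) :
  point -> W := 'D_(delta_mx 0 i) f.

(* christoffel g k i j is Gamma^k_ij *)
Definition christoffel (g : metric) (k i j : 'I_n.+1) (p : point) : R :=
  2^-1 * \sum_l invmx (g p) k l *
    (partial i (fun q => g q j l) p + partial j (fun q => g q i l) p
     - partial l (fun q => g q i j) p).

(* R(d_i, d_j) d_k = \sum_l (riemann g l i j k) d_l, with the convention
   R(X, Y) Z = nabla_X nabla_Y Z - nabla_Y nabla_X Z - nabla_[X, Y] Z *)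
Definition riemann (g : metric) (l i j k : 'I_n.+1) (p : point) : R :=
  partial i (christoffel g l j k) p - partial j (christoffel g l i k) p
  + \sum_m (christoffel g l i m p * christoffel g m j k p
            - christoffel g l j m p * christoffel g m i k p).

(* Ric(Y, Z) is the trace of X |-> R(X, Y) Z; round spheres have Ric > 0. *)
Definition ricci (g : metric) (p : point) : 'M[R]_n.+1 :=
  \matrix_(j, k) \sum_i riemann g i i j k p.

Definition lie_derivative (xi : point -> point) (g : metric) (p : point) :
    'M[R]_n.+1 :=
  \matrix_(i, j) \sum_k
    (xi p 0 k * partial k (fun q => g q i j) p
     + g p k j * partial i (fun q => xi q 0 k) p
     + g p i k * partial j (fun q => xi q 0 k) p).

Definition almost_ricci_soliton (D : set point) (g : metric)
    (xi : point -> point) (lam : point -> R) : Prop :=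
  smooth_on D lam /\
  forall p, D p -> 2^-1 *: lie_derivative xi g p + ricci g p = lam p *: g p.

End ChartGeometry.

(* Sphere stands for S^3 x R in E^5, Hyperbolic for H^3 x R in L^5. *)
Variant space_form := Sphere | Hyperbolic.

Section ProductSpaces.
Context {R : realType} (c : space_form).

(* The coordinates x_1, ..., x_5 are the entries 0, ..., 4. *)
Definition ambient_metric (y z : 'rV[R]_5) : R :=
  (match c with Sphere => 1 | Hyperbolic => -1 end) * (y 0 0 * z 0 0)
  + y 0 1 * z 0 1 + y 0 2 * z 0 2 + y 0 3 * z 0 3 + y 0 4 * z 0 4.

Definition product_space : set 'rV[R]_5 :=
  match c with
  | Sphere =>
    [set y | y 0 0 ^+ 2 + y 0 1 ^+ 2 + y 0 2 ^+ 2 + y 0 3 ^+ 2 = 1]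
  | Hyperbolic =>
    [set y | - y 0 0 ^+ 2 + y 0 1 ^+ 2 + y 0 2 ^+ 2 + y 0 3 ^+ 2 = -1
             /\ 0 < y 0 0]
  end.

Definition tangent_to (Q : set 'rV[R]_5) (y u : 'rV[R]_5) : Prop :=
  exists gamma : R -> 'rV[R]_5,
    [/\ forall t, Q (gamma t), gamma 0 = y & is_derive (0 : R) 1 gamma u].

(* Objects on a parametrized hypersurface x : D -> product_space are pulled
   back to the parameter domain D. *)

Definition induced_metric (x : 'rV[R]_3 -> 'rV[R]_5) (p : 'rV[R]_3) : 'M[R]_3 :=
  \matrix_(i, j) ambient_metric (partial i x p) (partial j x p).

Definition unit_normal_field (D : set 'rV[R]_3) (x : 'rV[R]_3 -> 'rV[R]_5)
    (N : 'rV[R]_3 -> 'rV[R]_5) : Prop :=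
  smooth_on D N /\
  forall p, D p ->
    [/\ tangent_to product_space (x p) (N p),
        forall i, ambient_metric (N p) (partial i x p) = 0 &
        ambient_metric (N p) (N p) = 1].

(* d/dx_5 = T + sigma N along x, where T has components T p 0 i in the
   coordinate frame of the hypersurface *)
Definition vertical_decomposition (D : set 'rV[R]_3)
    (x : 'rV[R]_3 -> 'rV[R]_5) (T : 'rV[R]_3 -> 'rV[R]_3)
    (sigma : 'rV[R]_3 -> R) (N : 'rV[R]_3 -> 'rV[R]_5) : Prop :=
  forall p, D p ->
    delta_mx 0 4 = \sum_i T p 0 i *: partial i x p + sigma p *: N p.

End ProductSpaces.

Section Hypersurfaces.
Context {R : realType}.

Definition cosh (t : R) : R := (expR t + expR (- t)) / 2.
Definition sinh (t : R) : R := (expR t - expR (- t)) / 2.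

Definition box (I J K : set R) : set 'rV[R]_3 :=
  [set p | [/\ I (p 0 0), J (p 0 1) & K (p 0 2)]].

Definition hypersurface (c : space_form) (a1 a2 : R -> R) (p : 'rV[R]_3) :
    'rV[R]_5 :=
  let s := p 0 0 in let v := p 0 1 in let w := p 0 2 in
  \row_(j < 5) match c with
  | Sphere => [:: cos (a1 s) * cos v; cos (a1 s) * sin v;
                  sin (a1 s) * cos w; sin (a1 s) * sin w; a2 s]
  | Hyperbolic => [:: cosh (a1 s) * cosh v; cosh (a1 s) * sinh v;
                      sinh (a1 s) * cos w; sinh (a1 s) * sin w; a2 s]
  end`_j.

Definition admissible (c : space_form) (t : R) : Prop :=
  match c with
  | Sphere => 0 < cos t /\ 0 < sin t
  | Hyperbolic => 0 < sinh t
  end.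

Lemma cosh2_sub_sinh2 (t : R) : cosh t ^+ 2 - sinh t ^+ 2 = 1.
Proof.
have e0 : expR t * expR (- t) = 1 by rewrite expRN mulfV // gt_eqF // expR_gt0.
by transitivity (expR t * expR (- t)) => //; rewrite /cosh /sinh; field.
Qed.

Lemma hypersurface_product_space (c : space_form) (a1 a2 : R -> R)
  (p : 'rV[R]_3) : product_space c (hypersurface c a1 a2 p).
Proof.
case: c; rewrite /product_space /hypersurface /= !mxE /=.
  transitivity (cos (a1 (p 0 0)) ^+ 2 * (cos (p 0 1) ^+ 2 + sin (p 0 1) ^+ 2)
    + sin (a1 (p 0 0)) ^+ 2 * (cos (p 0 2) ^+ 2 + sin (p 0 2) ^+ 2)).
    by ring.
  by rewrite !cos2Dsin2 !mulr1 cos2Dsin2.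
split.
  transitivity (- (cosh (a1 (p 0 0)) ^+ 2 * (cosh (p 0 1) ^+ 2 - sinh (p 0 1) ^+ 2)
    - sinh (a1 (p 0 0)) ^+ 2 * (cos (p 0 2) ^+ 2 + sin (p 0 2) ^+ 2))).
    by ring.
  by rewrite cos2Dsin2 cosh2_sub_sinh2 !mulr1 cosh2_sub_sinh2.
by rewrite mulr_gt0 // divr_gt0 // addr_gt0 ?expR_gt0.
Qed.

End Hypersurfaces.

(* Main.v *)
Require Import Defs.
From mathcomp Require Import all_boot all_order all_algebra.
From mathcomp Require Import all_classical all_reals all_analysis.
From mathcomp Require Import ring lra.
Import Order.TTheory GRing.Theory Num.Theory.
Import numFieldNormedType.Exports.
Local Open Scope classical_set_scope.
Local Open Scope ring_scope.

(** In the coordinates (s, v, w) both families have induced metric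
    ds^2 + P(s)^2 dv^2 + Q(s)^2 dw^2 with P = C o a1 and Q = S o a1, where (C, S)
    is (cos, sin) in the sphere case and (cosh, sinh) in the hyperbolic case.
    With e = 1, resp. e = -1, one has C' = - e S, S' = C and C^2 + e S^2 = 1, so
    the two cases can be treated together ([induced_metric_hypersurface]). Taking
    inner products of d/dx_5 with the coordinate frame gives T = a2' d/ds
    ([tangential_part]).

    The Ricci tensor of such a metric ([ricci_warped]) and the Lie derivative of
    g along T ([lie_derivative_warped]) turn the diagonal entries of the soliton
    equation into three equations on the profile functions:

      a2'' - P''/P - Q''/Q = lam,
      a2' P'/P - P''/P - P'Q'/(PQ) = lam,
      a2' Q'/Q - Q''/Q - P'Q'/(PQ) = lam.

    The difference of the last two gives a1'' = a1' a2', whence a2'' = - a1'^2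
    because of unit speed, then lam = 2 e a1'^2, and the first equation becomes
    a1' P Q = a2' (e Q^2 - P^2) ([profile_equations]). Differentiating this
    relation along the curve yields (1 - 4 e) a1' a2' P Q = 0, although no factor
    vanishes ([profile_inconsistent]). *)

Set Implicit Arguments.
Unset Strict Implicit.

(** * Derivation rules in pointwise form *)

Section DerivationRules.
Context {R : realType} {V : normedModType R}.
Implicit Types (f g : V -> R) (x v : V).

Lemma is_derive_mulr f g x v (df dg : R) :
  is_derive x v f df -> is_derive x v g dg ->
  is_derive x v (fun y => f y * g y) (df * g x + f x * dg).
Proof.
move=> hf hg; apply: (is_derive_eq (is_deriveM hf hg)).
by rewrite /GRing.scale /= addrC [g x * _]mulrC.
Qed.

Lemma is_derive_addr f g x v (df dg : R) :
  is_derive x v f df -> is_derive x v g dg ->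
  is_derive x v (fun y => f y + g y) (df + dg).
Proof. exact: is_deriveD. Qed.

Lemma is_derive_oppr f x v (df : R) :
  is_derive x v f df -> is_derive x v (fun y => - f y) (- df).
Proof. exact: is_deriveN. Qed.

Lemma is_derive_subr f g x v (df dg : R) :
  is_derive x v f df -> is_derive x v g dg ->
  is_derive x v (fun y => f y - g y) (df - dg).
Proof. exact: is_deriveB. Qed.

Lemma is_derive_sqr f x v (df : R) :
  is_derive x v f df -> is_derive x v (fun y => f y ^+ 2) (2 * f x * df).
Proof.
move=> hf; apply: (is_derive_eq (is_derive_mulr hf hf)).
by ring.
Qed.

End DerivationRules.

Lemma is_derive_inv (R : realType) (f : R -> R) (x v df : R) :
  f x != 0 -> is_derive x v f df ->
  is_derive x v (fun y => (f y)^-1) (- df / f x ^+ 2).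
Proof.
move=> fx0 hf; apply: (is_derive_eq (is_deriveV fx0 hf)).
by rewrite /GRing.scale /= mulNr mulNr mulrC.
Qed.

Lemma is_derive_div (R : realType) (f g : R -> R) (x v df dg : R) :
  g x != 0 -> is_derive x v f df -> is_derive x v g dg ->
  is_derive x v (fun y => f y / g y) (df / g x - f x * dg / g x ^+ 2).
Proof.
move=> gx0 hf hg.
apply: (is_derive_eq (is_derive_mulr hf (is_derive_inv gx0 hg))).
by rewrite mulrA mulrN mulNr.
Qed.

(** * Partial derivatives in a chart *)

Section FunctionsOfOneCoordinate.
Context {R : realType} {n : nat}.

(** The difference quotient of q |-> phi (q_k) at p along the i-th basis vector
    is literally that of phi at p_k along the scalar (i == k). *)
Lemma is_derive_coord (phi : R -> R) (p : 'rV[R]_n.+1) (i k : 'I_n.+1) (d : R) :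
  is_derive (p 0 k) 1 phi d ->
  is_derive p (delta_mx 0 i) (fun q : 'rV[R]_n.+1 => phi (q 0 k))
    ((i == k)%:R * d).
Proof.
move=> hphi.
have [h1 h2] : is_derive (p 0 k) ((i == k)%:R : R) phi ((i == k)%:R * d).
  by case: eqP => _; rewrite ?mul1r // mul0r; exact: is_derive0.
have E : (fun h : R => h^-1 *: (phi ((h *: delta_mx 0 i + p) 0 k) - phi (p 0 k)))
   = (fun h : R => h^-1 *: (phi (h *: (i == k)%:R + p 0 k) - phi (p 0 k))).
  by apply/funext => h; rewrite !mxE eqxx /= eq_sym.
apply: DeriveDef; first by rewrite /derivable E.
by rewrite -h2 /derive E.
Qed.

End FunctionsOfOneCoordinate.

Lemma open_box (R : realType) (I J K : set R) :
  open I -> open J -> open K -> open (box I J K).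
Proof.
move=> oI oJ oK.
have -> : box I J K = ((fun p : 'rV[R]_3 => p 0 0) @^-1` I)
   `&` ((fun p : 'rV[R]_3 => p 0 1) @^-1` J)
   `&` ((fun p : 'rV[R]_3 => p 0 2) @^-1` K).
  by apply/seteqP; split => p /=; rewrite /box /=; [case|case=> -[]].
by apply: openI; first apply: openI; apply: open_comp => // q _;
  exact: coord_continuous.
Qed.

Lemma invmx_diag (F : fieldType) n (d : 'rV[F]_n) :
  (forall k, d 0 k != 0) -> invmx (diag_mx d) = diag_mx (\row_k (d 0 k)^-1).
Proof.
move=> d0.
have E : diag_mx d *m diag_mx (\row_k (d 0 k)^-1) = 1%:M.
  apply/matrixP => i j; rewrite mul_diag_mx !mxE.
  by have [->|_] := eqVneq i j; rewrite ?mulr1n ?mulr0n ?mulfV ?mulr0.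
have [du _] := mulmx1_unit E.
by rewrite -[RHS]mul1mx -(mulVmx du) -mulmxA E mulmx1.
Qed.

(** On an open set the partial derivatives of f only depend on the restriction
    of f; f may be arbitrary outside of D. *)
Lemma partial_eq_on (R : realType) (n : nat) (D : set 'rV[R]_n.+1) (p : 'rV[R]_n.+1)
    (i : 'I_n.+1) (W : normedModType R) (f h : 'rV[R]_n.+1 -> W) (d : W) :
  open D -> D p -> (forall q, D q -> f q = h q) ->
  is_derive p (delta_mx 0 i) h d -> partial i f p = d.
Proof.
move=> oD Dp fh [_ <-]; apply: near_eq_derive.
have : nbhs p D by exact: open_nbhs_nbhs.
by apply: filterS => q /fh.
Qed.

Lemma partial_coord (R : realType) (n : nat) (D : set 'rV[R]_n.+1) (phi : R -> R)
    (f : 'rV[R]_n.+1 -> R) (i k : 'I_n.+1) (p : 'rV[R]_n.+1) (d : R) :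
  open D -> D p -> (forall q, D q -> f q = phi (q 0 k)) ->
  is_derive (p 0 k) 1 phi d -> partial i f p = (i == k)%:R * d.
Proof.
move=> oD Dp fphi dphi; apply: (partial_eq_on oD Dp fphi).
exact: is_derive_coord.
Qed.

(** * Diagonal metrics depending on the first coordinate *)

(** The metrics considered are sum_k u_k(s)^2 dx_k^2 on an open set D, where s is
    the coordinate of index 0 and u_0 = 1; u1 and u2 are the first and second
    derivatives of u. *)
Section DiagonalMetric.
Context {R : realType} {n : nat}.
Context (D : set 'rV[R]_n.+1) (I : set R).
Context (u u1 u2 : 'I_n.+1 -> R -> R) (g : 'rV[R]_n.+1 -> 'M[R]_n.+1).
Context (oD : open D) (DI : forall p, D p -> I (p 0 0)).
Context (u_neq0 : forall k s, I s -> u k s != 0).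
Context (u0E : forall s, I s -> u 0 s = 1) (u10E : forall s, I s -> u1 0 s = 0).
Context (du : forall k s, I s -> is_derive s 1 (u k) (u1 k s)).
Context (du1 : forall k s, I s -> is_derive s 1 (u1 k) (u2 k s)).
Context (gE : forall p, D p -> g p = diag_mx (\row_k u k (p 0 0) ^+ 2)).

Lemma partial_diag_metric i j l p : D p ->
  partial i (fun q => g q j l) p =
    (i == 0)%:R * ((j == l)%:R * (2 * u j (p 0 0) * u1 j (p 0 0))).
Proof.
move=> Dp; have Ip := DI Dp.
apply: (@partial_coord _ _ D (fun s => u j s ^+ 2 *+ (j == l))) => //.
  by move=> q Dq; rewrite gE // !mxE.
case: eqP => _ /=.
  by rewrite mul1r; apply: is_derive_sqr; exact: du.
by rewrite mul0r; exact: is_derive_cst.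
Qed.

(** Gamma^k_ij of the metric, as a function of s: the only nonzero symbols are
    Gamma^0_ii = - u_i u_i' and Gamma^k_0k = Gamma^k_k0 = u_k' / u_k for k != 0. *)
Definition diag_christoffel (k i j : 'I_n.+1) (s : R) : R :=
  if k == 0 then if i == j then - (u i s * u1 i s) else 0
  else if (i == 0) && (j == k) || (j == 0) && (i == k) then u1 k s / u k s else 0.

(** The derivative of [diag_christoffel k i j] with respect to s. *)
Definition diag_christoffel_der (k i j : 'I_n.+1) (s : R) : R :=
  if k == 0 then if i == j then - (u1 i s ^+ 2 + u i s * u2 i s) else 0
  else if (i == 0) && (j == k) || (j == 0) && (i == k)
  then u2 k s / u k s - u1 k s * u1 k s / u k s ^+ 2 else 0.

Lemma christoffel_diag k i j p : D p ->
  christoffel g k i j p = diag_christoffel k i j (p 0 0).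
Proof.
move=> Dp; have Ip := DI Dp; rewrite /christoffel.
(* The inverse metric is diagonal, so only the term l = k remains. *)
under eq_bigr => l _ do rewrite !partial_diag_metric //.
rewrite (bigD1 k) //= big1 ?addr0; last first.
  move=> l lk; rewrite gE // invmx_diag => [|m]; last first.
    by rewrite mxE sqrf_eq0 u_neq0.
  by rewrite !mxE eq_sym (negbTE lk) mul0r.
rewrite gE // invmx_diag => [|m]; last by rewrite mxE sqrf_eq0 u_neq0.
rewrite !mxE eqxx mulr1n /diag_christoffel.
have uk := u_neq0 k Ip; have ui := u_neq0 i Ip.
have [k0|k0] := eqVneq k 0.
  rewrite k0 u0E //; have [i0|i0] := eqVneq i 0.
    rewrite i0 [0 == j]eq_sym u10E //; have [j0|j0] := eqVneq j 0.
      by rewrite j0 u10E // /=; field.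
    by rewrite /=; field.
  have [ij|ij] := eqVneq i j; first by rewrite -ij (negbTE i0) /=; field.
  by have [j0|j0] := eqVneq j 0; rewrite ?u10E // /=; field.
have [i0|i0] := eqVneq i 0; have [jk|jk] := eqVneq j k => /=.
- by rewrite i0 jk [0 == k]eq_sym (negbTE k0) /=; field; exact: uk.
- rewrite i0 [0 == k]eq_sym (negbTE k0) andbF /=; field; exact: uk.
- by rewrite jk (negbTE k0) /=; field; exact: uk.
- have [j0|j0] := eqVneq j 0 => /=; last by field; exact: uk.
  by have [ik|ik] := eqVneq i k; rewrite ?ik /=; field; rewrite -?ik.
Qed.

Lemma is_derive_diag_christoffel k i j s : I s ->
  is_derive s 1 (diag_christoffel k i j) (diag_christoffel_der k i j s).
Proof.
move=> Is; rewrite /diag_christoffel /diag_christoffel_der.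
case: ifP => _; case: ifP => _; try exact: is_derive_cst.
  apply: (is_derive_eq (is_derive_oppr (is_derive_mulr (du i Is) (du1 i Is)))).
  by ring.
by apply: (is_derive_div (u_neq0 k Is) (du1 k Is) (du k Is)).
Qed.

Lemma riemann_diag l i j k p : D p ->
  riemann g l i j k p =
    (i == 0)%:R * diag_christoffel_der l j k (p 0 0)
    - (j == 0)%:R * diag_christoffel_der l i k (p 0 0)
    + \sum_m (diag_christoffel l i m (p 0 0) * diag_christoffel m j k (p 0 0)
            - diag_christoffel l j m (p 0 0) * diag_christoffel m i k (p 0 0)).
Proof.
move=> Dp; set s := p 0 0; rewrite /riemann.
have pE a b c d : partial a (christoffel g b c d) p
     = (a == 0)%:R * diag_christoffel_der b c d s.
  apply: (@partial_coord _ _ D (diag_christoffel b c d)) => //.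
    by move=> q Dq; exact: christoffel_diag.
  by apply: is_derive_diag_christoffel; exact: DI.
rewrite !pE; congr (_ + _); apply: eq_bigr => m _.
by rewrite !christoffel_diag.
Qed.

End DiagonalMetric.

(** * Doubly warped metrics in dimension three *)

Lemma forall_I3 (P : 'I_3 -> Prop) : P 0 -> P 1 -> P 2 -> forall i, P i.
Proof.
move=> P0 P1 P2 [[|[|[|//]]] h].
- by rewrite (_ : Ordinal h = 0) //; apply: val_inj.
- by rewrite (_ : Ordinal h = 1) //; apply: val_inj.
- by rewrite (_ : Ordinal h = 2) //; apply: val_inj.
Qed.

Lemma sum_I3 (V : zmodType) (F : 'I_3 -> V) : \sum_i F i = F 0 + F 1 + F 2.
Proof.
rewrite !big_ord_recl big_ord0 addr0 addrA.
by congr (F _ + F _ + F _); exact: val_inj.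
Qed.

(** The family (a, b, c) indexed by 'I_3. *)
Definition triple {T : Type} (a b c : T) : 'I_3 -> T :=
  fun k => nth a [:: a; b; c] k.

(** The metric ds^2 + f(s)^2 dv^2 + h(s)^2 dw^2 on an open set D; f1, f2 and
    h1, h2 are the first two derivatives of f and h. *)
Section WarpedMetric.
Context {R : realType} (D : set 'rV[R]_3) (I : set R).
Context (f f1 f2 h h1 h2 : R -> R) (g : 'rV[R]_3 -> 'M[R]_3).
Context (oD : open D) (DI : forall p, D p -> I (p 0 0)).
Context (f_neq0 : forall s, I s -> f s != 0) (h_neq0 : forall s, I s -> h s != 0).
Context (df : forall s, I s -> is_derive s 1 f (f1 s)).
Context (df1 : forall s, I s -> is_derive s 1 f1 (f2 s)).
Context (dh : forall s, I s -> is_derive s 1 h (h1 s)).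
Context (dh1 : forall s, I s -> is_derive s 1 h1 (h2 s)).
Context (gE : forall p, D p ->
  g p = diag_mx (\row_k triple (cst 1) f h k (p 0 0) ^+ 2)).

Let u := triple (cst 1) f h.
Let u1 := triple (cst 0) f1 h1.
Let u2 := triple (cst 0) f2 h2.

Let u_neq0 k s : I s -> u k s != 0.
Proof.
move: k s; apply: forall_I3 => t It /=;
  by [rewrite oner_eq0|exact: f_neq0|exact: h_neq0].
Qed.

Let du k s : I s -> is_derive s 1 (u k) (u1 k s).
Proof.
move: k s; apply: forall_I3 => t It /=;
  by [exact: is_derive_cst|exact: df|exact: dh].
Qed.

Let du1 k s : I s -> is_derive s 1 (u1 k) (u2 k s).
Proof.
move: k s; apply: forall_I3 => t It /=;
  by [exact: is_derive_cst|exact: df1|exact: dh1].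
Qed.

(** The Ricci tensor; its trace-type definition uses the curvature components
    R(d_i, d_j) d_j, which only involve s-derivatives of the Christoffel symbols. *)
Lemma ricci_warped p : D p -> let s := p 0 0 in
  [/\ ricci g p 0 0 = - (f2 s / f s) - h2 s / h s,
      ricci g p 1 1 = - (f s * f2 s) - f s * f1 s * h1 s / h s &
      ricci g p 2 2 = - (h s * h2 s) - h s * h1 s * f1 s / f s].
Proof.
move=> Dp s; have Is : I s := DI Dp.
have fs := f_neq0 Is; have hs := h_neq0 Is.
have RE l i j k := @riemann_diag _ _ D I u u1 u2 g oD DI u_neq0
  (fun _ _ => erefl) (fun _ _ => erefl) du du1 gE l i j k p Dp.
rewrite !mxE !sum_I3 !RE !sum_I3 -/s /diag_christoffel /diag_christoffel_der.
rewrite /u /u1 /u2 /triple /=.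
by split; field; rewrite ?fs ?hs.
Qed.

(** The Lie derivative of the metric along the field b(s) d/ds. *)
Lemma lie_derivative_warped (xi : 'rV[R]_3 -> 'rV[R]_3) (b b1 : R -> R) p : D p ->
  (forall s, I s -> is_derive s 1 b (b1 s)) ->
  (forall q, D q -> xi q = b (q 0 0) *: delta_mx 0 0) ->
  let s := p 0 0 in
  [/\ lie_derivative xi g p 0 0 = 2 * b1 s,
      lie_derivative xi g p 1 1 = 2 * (b s * f s * f1 s) &
      lie_derivative xi g p 2 2 = 2 * (b s * h s * h1 s)].
Proof.
move=> Dp db xiE s; have Is : I s := DI Dp.
have gd i j l := @partial_diag_metric _ _ D I u u1 g oD DI du gE i j l p Dp.
have xid i k :
    partial i (fun q => xi q 0 k) p = (i == 0)%:R * ((k == 0)%:R * b1 s).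
  apply: (@partial_coord _ _ D (fun t => (k == 0)%:R * b t)) => //.
    by move=> q Dq; rewrite xiE // !mxE eqxx mulrC.
  apply: (is_derive_eq
    (is_derive_mulr (is_derive_cst ((k == 0)%:R : R) s 1) (db _ Is))).
  by rewrite mul0r add0r.
rewrite !mxE !sum_I3 !gd !xid gE // xiE // !mxE /u /u1 /triple -/s /=.
by split; ring.
Qed.

End WarpedMetric.

(** * Circular and hyperbolic functions together *)

Section GeneralizedTrigonometry.
Context {R : realType} (c : space_form).

(** The curvature of the space form, 1 for the sphere and -1 for hyperbolic
    space. It is also the coefficient of dx_1^2 in the ambient metric. *)
Definition curv : R := match c with Sphere => 1 | Hyperbolic => -1 end.
(** [gcos] and [gsin] solve y'' = - curv * y with initial data (1, 0) and
    (0, 1) respectively. *)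
Definition gcos : R -> R := match c with Sphere => cos | Hyperbolic => cosh end.
Definition gsin : R -> R := match c with Sphere => sin | Hyperbolic => sinh end.

Lemma curv_sqr : curv * curv = 1.
Proof. by rewrite /curv; case: c; rewrite ?mulrNN mulr1. Qed.

Lemma gcos2_gsin2 (t : R) : gcos t ^+ 2 + curv * gsin t ^+ 2 = 1.
Proof.
rewrite /gcos /gsin /curv; case: c; first by rewrite mul1r cos2Dsin2.
by rewrite mulN1r cosh2_sub_sinh2.
Qed.

Lemma is_derive_gcos (t : R) : is_derive t 1 gcos (- (curv * gsin t)).
Proof.
rewrite /gcos /gsin /curv; case: c; first by rewrite mul1r; exact: is_derive_cos.
have d1 : is_derive t 1 (fun x : R => expR (- x)) (expR (- t) * (-1)).
  exact: is_derive1_comp.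
apply: (is_derive_eq (is_derive_mulr (is_deriveD (is_derive_expR t) d1)
  (is_derive_cst (2^-1 : R) t 1))).
by rewrite /sinh mulr0 addr0 /cst; ring.
Qed.

Lemma is_derive_gsin (t : R) : is_derive t 1 gsin (gcos t).
Proof.
rewrite /gcos /gsin; case: c; first exact: is_derive_sin.
have d1 : is_derive t 1 (fun x : R => expR (- x)) (expR (- t) * (-1)).
  exact: is_derive1_comp.
apply: (is_derive_eq (is_derive_mulr (is_deriveB (is_derive_expR t) d1)
  (is_derive_cst (2^-1 : R) t 1))).
by rewrite /cosh mulr0 addr0 /cst; ring.
Qed.

Lemma admissible_gcos (t : R) : admissible c t -> gcos t != 0.
Proof.
rewrite /gcos; case: c => /= [[+ _]|_]; first by move=> /gt_eqF ->.
by rewrite gt_eqF // divr_gt0 // addr_gt0 ?expR_gt0.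
Qed.

Lemma admissible_gsin (t : R) : admissible c t -> gsin t != 0.
Proof. by rewrite /gsin; case: c => /= [[_ ]|] /gt_eqF ->. Qed.

End GeneralizedTrigonometry.

(** * Geometry of the hypersurfaces *)

(** If the vertical vector d/dx_5 is decomposed on vectors y_i and a vector nu
    orthogonal to them, its coordinates t_i solve the linear system given by the
    Gram matrix of the y_i and the heights of the y_j. *)
Lemma vertical_coordinates (R : realType) (c : space_form) (t : 'I_3 -> R)
    (y : 'I_3 -> 'rV[R]_5) (sg : R) (nu : 'rV[R]_5) (j : 'I_3) :
  delta_mx 0 4 = \sum_i t i *: y i + sg *: nu ->
  ambient_metric c nu (y j) = 0 ->
  \sum_i t i * ambient_metric c (y i) (y j) = y j 0 4.
Proof.
move=> h nuy.
transitivity (ambient_metric c (delta_mx 0 4) (y j)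
  - sg * ambient_metric c nu (y j)).
  by rewrite h !sum_I3 /ambient_metric !mxE; ring.
by rewrite nuy mulr0 subr0 /ambient_metric !mxE /=; ring.
Qed.

Section InducedMetric.
Context {R : realType} (c : space_form) (I J K : set R) (a b da db : R -> R).
Context (a_der : forall s, I s -> is_derive s 1 a (da s)).
Context (b_der : forall s, I s -> is_derive s 1 b (db s)).
Notation C := (gcos c).
Notation S := (gsin c).
Notation e := (curv c).
Notation x := (hypersurface c a b).

(** The coordinate tangent vectors: [frame i] is the partial derivative of the
    parametrization with respect to s, v or w, for i = 0, 1, 2. *)
Definition frame (i : 'I_3) (p : 'rV[R]_3) : 'rV[R]_5 :=
  let s := p 0 0 in let v := p 0 1 in let w := p 0 2 in
  \row_j [:: (i == 0)%:R * (- (e * S (a s)) * da s) * C v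
               + C (a s) * ((i == 1)%:R * - (e * S v));
             (i == 0)%:R * (- (e * S (a s)) * da s) * S v
               + C (a s) * ((i == 1)%:R * C v);
             (i == 0)%:R * (C (a s) * da s) * cos w
               + S (a s) * ((i == 2)%:R * - sin w);
             (i == 0)%:R * (C (a s) * da s) * sin w
               + S (a s) * ((i == 2)%:R * cos w);
             (i == 0)%:R * db s]`_j.

Lemma partial_hypersurface i p : box I J K p -> partial i x p = frame i p.
Proof.
move=> Dp; have [Is _ _] := Dp.
have dCa := is_derive1_comp (is_derive_gcos c (a (p 0 0))) (a_der Is).
have dSa := is_derive1_comp (is_derive_gsin c (a (p 0 0))) (a_der Is).
have dx j : is_derive p (delta_mx 0 i) (fun q => x q 0 j) (frame i p 0 j).
  have -> : (fun q => x q 0 j) = (fun q : 'rV[R]_3 =>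
    [:: C (a (q 0 0)) * C (q 0 1); C (a (q 0 0)) * S (q 0 1);
        S (a (q 0 0)) * cos (q 0 2); S (a (q 0 0)) * sin (q 0 2); b (q 0 0)]`_j).
    by apply/funext => q; rewrite !mxE /gcos /gsin; case: c.
  rewrite !mxE; move: j => [[|[|[|[|[|//]]]]] /= _].
  - apply: is_derive_mulr; first exact: (is_derive_coord _ dCa).
    exact: (is_derive_coord _ (is_derive_gcos c _)).
  - apply: is_derive_mulr; first exact: (is_derive_coord _ dCa).
    exact: (is_derive_coord _ (is_derive_gsin c _)).
  - apply: is_derive_mulr; first exact: (is_derive_coord _ dSa).
    exact: (is_derive_coord _ (is_derive_cos _)).
  - apply: is_derive_mulr; first exact: (is_derive_coord _ dSa).
    exact: (is_derive_coord _ (is_derive_sin _)).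
  - exact: (is_derive_coord _ (b_der Is)).
rewrite /partial derive_mx.
  by apply/matrixP => r j; rewrite (ord1 r) mxE; have [_ ->] := dx j.
by apply/derivable_mxP => r j; rewrite (ord1 r); have [] := dx j.
Qed.

Context (unit_speed : forall s, I s -> da s ^+ 2 + db s ^+ 2 = 1).

Lemma induced_metric_hypersurface p : box I J K p ->
  induced_metric c x p =
  diag_mx (\row_k triple (cst 1) (C \o a) (S \o a) k (p 0 0) ^+ 2).
Proof.
move=> Dp; have [Is _ _] := Dp.
apply/matrixP => i j; rewrite !mxE !partial_hypersurface //.
rewrite /ambient_metric -/(@curv R c) !mxE /triple.
set s := p 0 0; set v := p 0 1; set w := p 0 2.
have hs := unit_speed Is; have hw := cos2Dsin2 w.
have ha := gcos2_gsin2 c (a s); have hv := gcos2_gsin2 c v.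
have he := @curv_sqr R c.
have hv' : e * C v ^+ 2 + S v ^+ 2 = e.
  by rewrite -[RHS]mulr1 -hv mulrDr mulrA he mul1r.
(* The ambient products are arranged so that the factors C^2 + e S^2,
   e C^2 + S^2, e * e and cos^2 + sin^2 become visible. *)
move: i j; apply: forall_I3; apply: forall_I3 => /=; rewrite ?mulr1n ?mulr0n.
- transitivity (da s ^+ 2 * (S (a s) ^+ 2 * ((e * e) * (e * C v ^+ 2 + S v ^+ 2))
    + C (a s) ^+ 2 * (cos w ^+ 2 + sin w ^+ 2)) + db s ^+ 2); first by ring.
  rewrite he hv' hw mul1r !mulr1 expr1n -hs; congr (_ + _).
  by rewrite -[RHS]mulr1 -ha; ring.
- transitivity (S (a s) * C (a s) * C v * S v * da s * e * (e * e - 1)).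
    by ring.
  by rewrite he subrr mulr0.
- by ring.
- transitivity (S (a s) * C (a s) * C v * S v * da s * e * (e * e - 1)).
    by ring.
  by rewrite he subrr mulr0.
- transitivity (C (a s) ^+ 2 * (C v ^+ 2 + (e * e) * (e * S v ^+ 2))).
    by ring.
  by rewrite he mul1r hv mulr1.
- by ring.
- by ring.
- by ring.
- transitivity (S (a s) ^+ 2 * (cos w ^+ 2 + sin w ^+ 2)); first by ring.
  by rewrite hw mulr1.
Qed.

(** The tangential part of d/dx_5 is db(s) d/ds: the coordinate fields d/dv and
    d/dw are horizontal and d/ds is a unit field of height db. *)
Lemma tangential_part (T : 'rV[R]_3 -> 'rV[R]_3) (sigma : 'rV[R]_3 -> R)
    (N : 'rV[R]_3 -> 'rV[R]_5) p :
  (forall s, I s -> C (a s) != 0) -> (forall s, I s -> S (a s) != 0) ->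
  unit_normal_field c (box I J K) x N ->
  vertical_decomposition (box I J K) x T sigma N ->
  box I J K p -> T p = db (p 0 0) *: delta_mx 0 0.
Proof.
move=> C0 S0 [_ hN] hT Dp; have [Is _ _] := Dp.
have [_ NT _] := hN _ Dp.
have gE i j : ambient_metric c (partial i x p) (partial j x p) =
    diag_mx (\row_k triple (cst 1) (C \o a) (S \o a) k (p 0 0) ^+ 2) i j.
  by rewrite -(induced_metric_hypersurface Dp) mxE.
have TE j : T p 0 j * triple (cst 1) (C \o a) (S \o a) j (p 0 0) ^+ 2 =
    (j == 0)%:R * db (p 0 0).
  have := vertical_coordinates (hT _ Dp) (NT j).
  rewrite (partial_hypersurface j Dp) [RHS]mxE /= => <-.
  rewrite (bigD1 j) //= big1 ?addr0 => [|i ij].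
    by rewrite -(partial_hypersurface j Dp) gE !mxE eqxx mulr1n.
  by rewrite -(partial_hypersurface j Dp) gE !mxE (negbTE ij) mulr0n mulr0.
apply/matrixP => r j; rewrite (ord1 r) !mxE eqxx /=.
have := TE j; rewrite /triple.
move: j; apply: forall_I3 => /=.
- by rewrite expr1n mul1r !mulr1.
- move=> /eqP; rewrite mul0r mulf_eq0 sqrf_eq0 (negbTE (C0 _ Is)) orbF.
  by move=> /eqP ->; rewrite mulr0.
- move=> /eqP; rewrite mul0r mulf_eq0 sqrf_eq0 (negbTE (S0 _ Is)) orbF.
  by move=> /eqP ->; rewrite mulr0.
Qed.

End InducedMetric.

(** * The equations of the profile curve *)

Lemma is_derive_unique_on (R : realType) (I : set R) (f h : R -> R) (s df dh : R) :
  open I -> I s -> (forall t, I t -> f t = h t) ->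
  is_derive s 1 f df -> is_derive s 1 h dh -> df = dh.
Proof.
move=> oI Is fh [_ <-] [_ <-]; apply: near_eq_derive.
have : nbhs s I by exact: open_nbhs_nbhs.
by apply: filterS => t /fh.
Qed.

(** The profile curve (a, b) with its first derivatives da, db and second
    derivatives d2a, d2b. *)
Section ProfileEquations.
Context {R : realType} (c : space_form) (I : set R) (a b da db d2a d2b : R -> R).
Context (oI : open I).
Context (a_der : forall s, I s -> is_derive s 1 a (da s)).
Context (da_der : forall s, I s -> is_derive s 1 da (d2a s)).
Context (b_der : forall s, I s -> is_derive s 1 b (db s)).
Context (db_der : forall s, I s -> is_derive s 1 db (d2b s)).
Context (unit_speed : forall s, I s -> da s ^+ 2 + db s ^+ 2 = 1).
Context (da_neq0 : forall s, I s -> da s != 0).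
Context (db_neq0 : forall s, I s -> db s != 0).
Context (C_neq0 : forall s, I s -> gcos c (a s) != 0).
Context (S_neq0 : forall s, I s -> gsin c (a s) != 0).
Notation e := (curv c).

(* The warping functions of the induced metric and their first two derivatives. *)
Let P s := gcos c (a s).
Let Q s := gsin c (a s).
Let P1 s := - (e * Q s) * da s.
Let Q1 s := P s * da s.
Let P2 s := - e * (P s * da s ^+ 2 + Q s * d2a s).
Let Q2 s := P s * d2a s - e * Q s * da s ^+ 2.

Let P_der s : I s -> is_derive s 1 P (P1 s).
Proof.
move=> Is; exact: (is_derive1_comp (is_derive_gcos c (a s)) (a_der Is)).
Qed.

Let Q_der s : I s -> is_derive s 1 Q (Q1 s).
Proof.
move=> Is; exact: (is_derive1_comp (is_derive_gsin c (a s)) (a_der Is)).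
Qed.

Let P1_der s : I s -> is_derive s 1 P1 (P2 s).
Proof.
move=> Is; apply: (is_derive_eq (is_derive_mulr
  (is_derive_oppr (is_derive_mulr (is_derive_cst e s 1) (Q_der Is)))
  (da_der Is))).
by rewrite /P2 /Q1 /cst; ring.
Qed.

Let Q1_der s : I s -> is_derive s 1 Q1 (Q2 s).
Proof.
move=> Is.
apply: (is_derive_eq (is_derive_mulr (P_der Is) (da_der Is))).
by rewrite /Q2 /P1; ring.
Qed.

Lemma unit_speed_derivative s : I s -> da s * d2a s + db s * d2b s = 0.
Proof.
move=> Is.
have h : 2 * da s * d2a s + 2 * db s * d2b s = 0.
  apply: (@is_derive_unique_on _ I (fun t => da t ^+ 2 + db t ^+ 2)
    (cst 1) s) => //.
  by apply: is_derive_addr; apply: is_derive_sqr; [exact: da_der|exact: db_der].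
have two_neq0 : (2 : R) != 0 by rewrite pnatr_eq0.
by apply: (mulfI two_neq0); rewrite mulr0 -h; ring.
Qed.

(** The hypotheses are the three diagonal entries of the soliton equation, with
    soliton function l at the parameter s. *)
Lemma profile_equations s (l : R) : I s ->
  d2b s - P2 s / P s - Q2 s / Q s = l ->
  db s * P s * P1 s - P s * P2 s - P s * P1 s * Q1 s / Q s = l * P s ^+ 2 ->
  db s * Q s * Q1 s - Q s * Q2 s - Q s * Q1 s * P1 s / P s = l * Q s ^+ 2 ->
  [/\ d2a s = da s * db s, d2b s = - da s ^+ 2 &
      da s * (P s * Q s) = db s * (e * Q s ^+ 2 - P s ^+ 2)].
Proof.
move=> Is E0 E1 E2.
have p0 : P s != 0 := C_neq0 Is; have q0 : Q s != 0 := S_neq0 Is.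
have d0 := da_neq0 Is; have b0 := db_neq0 Is.
have PQ : P s ^+ 2 + e * Q s ^+ 2 = 1 := gcos2_gsin2 c (a s).
(* The two equations in the v and w directions, divided by P and by Q. *)
have X1 : e * (d2a s - da s * db s) * Q s + 2 * e * da s ^+ 2 * P s = l * P s.
  apply: (mulIf p0); rewrite -[RHS]mulrA -expr2 -E1 /P2 /P1 /Q1.
  by field; exact: q0.
have X2 : (da s * db s - d2a s) * P s + 2 * e * da s ^+ 2 * Q s = l * Q s.
  apply: (mulIf q0); rewrite -[RHS]mulrA -expr2 -E2 /Q2 /Q1 /P1.
  by field; exact: p0.
(* Q times the first minus P times the second is the difference of the two
   sides times P^2 + e Q^2 = 1. *)
have A : d2a s = da s * db s.
  apply/eqP; rewrite -subr_eq0; apply/eqP; rewrite -[LHS]mulr1 -PQ.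
  transitivity ((l * P s) * Q s - (l * Q s) * P s); last by ring.
  by rewrite -X1 -X2; ring.
have B : d2b s = - da s ^+ 2.
  apply: (mulfI b0); apply/eqP; rewrite -subr_eq0; apply/eqP.
  by rewrite -(unit_speed_derivative Is) A; ring.
have L : l = 2 * e * da s ^+ 2.
  by apply: (mulIf p0); rewrite -X1 A; ring.
split => //.
apply: (mulfI d0); apply/eqP; rewrite -subr_eq0; apply/eqP.
transitivity ((l - (d2b s - P2 s / P s - Q2 s / Q s)) * (P s * Q s)); last first.
  by rewrite E0 subrr mul0r.
by rewrite /P2 /Q2 L A B; field; rewrite p0 q0.
Qed.

(** Differentiating the third relation contradicts the first two. *)
Lemma profile_inconsistent s : I s ->
  (forall t, I t -> [/\ d2a t = da t * db t, d2b t = - da t ^+ 2 &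
      da t * (P t * Q t) = db t * (e * Q t ^+ 2 - P t ^+ 2)]) -> False.
Proof.
move=> Is H; have [A B _] := H _ Is.
have F : da s * db s * (P s * Q s) + da s * (P1 s * Q s + P s * Q1 s) =
    - da s ^+ 2 * (e * Q s ^+ 2 - P s ^+ 2)
    + db s * (e * (2 * Q s * Q1 s) - 2 * P s * P1 s).
  rewrite -B -A.
  apply: (@is_derive_unique_on _ I (fun t => da t * (P t * Q t))
    (fun t => db t * (e * Q t ^+ 2 - P t ^+ 2)) s) => //.
  - by move=> t It; have [] := H _ It.
  - apply: is_derive_mulr; first exact: da_der.
    by apply: is_derive_mulr; [exact: P_der|exact: Q_der].
  - apply: is_derive_mulr; first exact: db_der.
    apply: is_derive_subr; last by apply: is_derive_sqr; exact: P_der.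
    apply: (is_derive_eq (is_derive_mulr (is_derive_cst e s 1)
      (is_derive_sqr (Q_der Is)))).
    by rewrite mul0r add0r.
(* Subtracting the two sides leaves a multiple of the nonzero a' b' P Q; the
   factor is -3 for the sphere and 5 for hyperbolic space. *)
have : (1 - 4 * e) * (da s * db s * (P s * Q s)) = 0.
  by move/eqP: F; rewrite -subr_eq0 => /eqP <-; rewrite /P1 /Q1; ring.
apply/eqP; rewrite !mulf_neq0 ?da_neq0 ?db_neq0 ?C_neq0 ?S_neq0 //.
by rewrite /curv; case: (c); rewrite ?mulrN ?mulr1; lra.
Qed.

Lemma rotation_hypersurface_not_soliton (J K : set R) (T : 'rV[R]_3 -> 'rV[R]_3)
    (lam : 'rV[R]_3 -> R) :
  open J -> open K -> I !=set0 -> J !=set0 -> K !=set0 ->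
  (forall p, box I J K p -> T p = db (p 0 0) *: delta_mx 0 0) ->
  ~ almost_ricci_soliton (box I J K)
      (induced_metric c (hypersurface c a b)) T lam.
Proof.
move=> oJ oK [s0 Is0] [v0 Jv0] [w0 Kw0] TE [_ soliton].
apply: (profile_inconsistent Is0) => s Is.
pose p : 'rV[R]_3 := \row_i triple s v0 w0 i.
have ps : p 0 0 = s by rewrite mxE.
have Dp : box I J K p by split; rewrite mxE.
have oD := open_box oI oJ oK.
have DI q : box I J K q -> I (q 0 0) by case.
have gE := @induced_metric_hypersurface R c I J K a b da db
  a_der b_der unit_speed.
have [R0 R1 R2] := ricci_warped oD DI C_neq0 S_neq0
  P_der P1_der Q_der Q1_der gE Dp.
have [L0 L1 L2] := lie_derivative_warped oD DI P_der Q_der gE Dp db_der TE.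
(* The diagonal entries of the soliton equation at p. *)
have solE i : 2^-1 * lie_derivative T (induced_metric c (hypersurface c a b)) p i i
    + ricci (induced_metric c (hypersurface c a b)) p i i
    = lam p * triple (cst 1) P Q i s ^+ 2.
  have diagE (A B : 'M[R]_3) (d : 'rV[R]_3) k :
      2^-1 *: A + B = k *: diag_mx d -> 2^-1 * A i i + B i i = k * d 0 i.
    by move=> /(congr1 (fun M : 'M[R]_3 => M i i)); rewrite !mxE eqxx mulr1n.
  have := soliton p Dp; rewrite (gE p Dp) => /diagE ->.
  by rewrite mxE ps.
rewrite ps in R0 R1 R2 L0 L1 L2.
have := solE 0; have := solE 1; have := solE 2.
rewrite R0 R1 R2 L0 L1 L2 /triple /= => E2 E1 E0.
have half (y : R) : 2^-1 * (2 * y) = y by rewrite mulKf // pnatr_eq0.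
apply: (profile_equations (l := lam p) Is).
- by rewrite -[RHS]mulr1 -(expr1n _ 2) -E0 half addrA.
- by rewrite -E1 half addrA.
- by rewrite -E2 half addrA.
Qed.

End ProfileEquations.

(** * Nonexistence of the soliton structure *)

Unset Implicit Arguments.
Set Strict Implicit.

Theorem proposition4p8 (R : realType) (c : space_form) (I J K : set R)
    (a1 a2 : R -> R)
    (N : 'rV[R]_3 -> 'rV[R]_5) (sigma : 'rV[R]_3 -> R)
    (T : 'rV[R]_3 -> 'rV[R]_3)
    (hI : [/\ open I, is_interval I & I !=set0])
    (hJ : [/\ open J, is_interval J & J !=set0])
    (hK : [/\ open K, is_interval K & K !=set0])
    (ha1 : smooth_on I a1) (ha2 : smooth_on I a2)
    (harc : forall s, I s -> derive1 a1 s ^+ 2 + derive1 a2 s ^+ 2 = 1)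
    (ha1' : forall s, I s -> derive1 a1 s != 0)
    (ha2' : forall s, I s -> derive1 a2 s != 0)
    (hadm : forall s, I s -> admissible c (a1 s))
    (hN : unit_normal_field c (box I J K) (hypersurface c a1 a2) N)
    (hT : vertical_decomposition (box I J K) (hypersurface c a1 a2) T sigma N) :
  ~ exists lam : 'rV[R]_3 -> R,
      almost_ricci_soliton (box I J K)
        (induced_metric c (hypersurface c a1 a2)) T lam.
Proof.
move=> [lam soliton].
have [oI _ I0] := hI; have [oJ _ J0] := hJ; have [oK _ K0] := hK.
(* The first two derivatives come from smoothness along the empty list of
   directions and along the list with the single direction 1. *)
set b1 := 'D_1 a1; set b2 := 'D_1 a2.
have da1 s : I s -> is_derive s 1 a1 (b1 s).
  by move=> Is; apply/derivableP/diff_derivable/(ha1 [::]).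
have dda1 s : I s -> is_derive s 1 b1 ('D_1 b1 s).
  by move=> Is; apply/derivableP/diff_derivable/(ha1 [:: 1]).
have da2 s : I s -> is_derive s 1 a2 (b2 s).
  by move=> Is; apply/derivableP/diff_derivable/(ha2 [::]).
have dda2 s : I s -> is_derive s 1 b2 ('D_1 b2 s).
  by move=> Is; apply/derivableP/diff_derivable/(ha2 [:: 1]).
have speed s : I s -> b1 s ^+ 2 + b2 s ^+ 2 = 1.
  by move=> /harc; rewrite !derive1E.
have b1_neq0 s : I s -> b1 s != 0 by move=> /ha1'; rewrite derive1E.
have b2_neq0 s : I s -> b2 s != 0 by move=> /ha2'; rewrite derive1E.
have C0 s : I s -> gcos c (a1 s) != 0 by move=> Is; exact/admissible_gcos/hadm.
have S0 s : I s -> gsin c (a1 s) != 0 by move=> Is; exact/admissible_gsin/hadm.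
have TE p : box I J K p -> T p = b2 (p 0 0) *: delta_mx 0 0.
  exact: (tangential_part da1 da2 speed C0 S0 hN hT).
exact: (rotation_hypersurface_not_soliton oI da1 dda1 da2 dda2 speed
  b1_neq0 b2_neq0 C0 S0 oJ oK I0 J0 K0 TE soliton).
Qed.
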